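(* For every $d\ge2$ and every $\epsilon\le\frac1{10}$, any bounded-error non-adaptive $\epsilon$-tester for convexity of functions $f\colon[n]^d\to\mathbb{R}$ has query complexity $\Omega\!\left((\tfrac nd)^{d/2}\right)$.
   Context: $[n]=\{0,\dots,n-1\}$ and $[n]^d\subseteq\mathbb{R}^d$. A function $f\colon X\to\mathbb{R}$ on a finite set $X\subseteq\mathbb{R}^d$ is convex if for every finite collection $x_1,\dots,x_k\in X$ and reals $\lambda_i\ge0$ with $\sum_i\lambda_i=1$ and $\sum_i\lambda_ix_i\in X$, one has $f(\sum_i\lambda_ix_i)\le\sum_i\lambda_if(x_i)$. $g$ is $\epsilon$-far from convex if every convex $h$ differs from $g$ on at least $\epsilon|X|$ points. A bounded-error $\epsilon$-tester is a randomized query algorithm accepting convex functions with probability at least $2/3$ and rejecting $\epsilon$-far functions with probability at least $2/3$; it is non-adaptive if all queried points are chosen before any value is observed. *)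

(* Defs.v *)
From HB Require Import structures.
From mathcomp Require Import all_boot all_order all_algebra.
From mathcomp Require Import all_classical all_reals all_analysis.
Set Implicit Arguments. Unset Strict Implicit. Unset Printing Implicit Defensive.
Import Order.TTheory GRing.Theory Num.Theory.
Local Open Scope classical_set_scope.
Local Open Scope ring_scope.

(* The grid [n]^d, with [n] = {0,...,n-1}: a point is a map 'I_d -> 'I_n,
   viewed in R^d through its coordinates (x j : nat)%:R. *)
Definition grid (n d : nat) : finType := {ffun 'I_d -> 'I_n}.

Section Convexity.
Variables (R : realType) (n d : nat).

Definition grid_convex (f : grid n d -> R) : Prop :=
  forall (k : nat) (x : 'I_k -> grid n d) (lam : 'I_k -> R) (y : grid n d),
    (forall i, 0 <= lam i) ->
    \sum_(i < k) lam i = 1 ->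
    (forall j : 'I_d, \sum_(i < k) lam i * ((x i j : nat)%:R) = ((y j : nat)%:R)) ->
    f y <= \sum_(i < k) lam i * f (x i).

Definition eps_far (eps : R) (g : grid n d -> R) : Prop :=
  forall h : grid n d -> R, grid_convex h ->
    eps * (#|[set: grid n d]|%:R) <= (#|[set x | g x != h x]|%:R).

(* A randomized non-adaptive algorithm making q queries: on the probability
   space (Omega, P), the random seed w determines the query points Q w
   (chosen before any value is observed) and the decision D w, which only
   sees the q queried values.  It is a bounded-error eps-tester for convexity
   if the acceptance events are measurable, convex functions are accepted
   with probability >= 2/3, and eps-far functions rejected with prob. >= 2/3. *)
Definition nonadaptive_convexity_tester (eps : R) (q : nat)
    (dm : measure_display) (Omega : measurableType dm) (P : probability Omega R)
    (Q : Omega -> 'I_q -> grid n d) (D : Omega -> ('I_q -> R) -> bool) : Prop :=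
  (forall f : grid n d -> R,
      measurable [set w | D w (fun i => f (Q w i))]) /\
  (forall f : grid n d -> R, grid_convex f ->
      ((2 / 3 : R)%:E <= P [set w | D w (fun i => f (Q w i))])%E) /\
  (forall f : grid n d -> R, eps_far eps f ->
      ((2 / 3 : R)%:E <= P [set w | ~~ D w (fun i => f (Q w i))])%E).

End Convexity.

(* Main.v *)
(* An integer vector v with |v|_1 <= n/3 and coprime entries v_0, v_1 cuts the grid
   into blocks, the windows of three consecutive points on the lines of direction
   v.  A convex base function that is affine on every block, and strictly convex
   across blocks, remains convex when a small constant is added on each block.
   The convex instances add a uniformly random constant u(B) / 60, u(B) in Z/60, on
   each block B; the far instances moreover shift u(B) by 1 modulo 60 at the central
   point of B, which breaks convexity inside B unless the shift wraps around.  At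
   least a ninth of the points are centres of complete blocks, so the far instances
   are 1/10-far for at least 5/6 of the seeds.  A single query per block sees the
   same distribution in both cases, so a tester has to hit some block twice.  Two
   points of a block differ by +-v or +-2v: a set of q queries can succeed for at
   most 4 q^2 directions v, whereas there are at least c (n/d)^d of them. *)

Require Import Defs.
From HB Require Import structures.
From mathcomp Require Import all_boot all_order all_algebra.
From mathcomp Require Import all_classical all_reals all_analysis measurable_realfun.
From mathcomp Require Import zify ring lra.
Set Implicit Arguments. Unset Strict Implicit. Unset Printing Implicit Defensive.
Import Order.TTheory GRing.Theory Num.Theory.
Local Open Scope ring_scope.

(** * Convexity and the block decomposition *)

Section GridConvexity.
Variables (R : realType) (n d : nat).
Implicit Types (f h T : grid n d -> R) (x y a b : grid n d).

Definition grid_affine T := forall (k : nat) (x : 'I_k -> grid n d)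
    (lam : 'I_k -> R) y,
  \sum_(i < k) lam i = 1 ->
  (forall j, \sum_(i < k) lam i * (x i j : nat)%:R = (y j : nat)%:R) ->
  \sum_(i < k) lam i * T (x i) = T y.

Lemma grid_affine_cst (c : R) : grid_affine (fun=> c).
Proof. by move=> k x lam y s1 _; rewrite -mulr_suml s1 mul1r. Qed.

Lemma grid_affine_coord (j : 'I_d) : grid_affine (fun x => (x j : nat)%:R).
Proof. by move=> k x lam y _; apply. Qed.

Lemma grid_affineD T1 T2 : grid_affine T1 -> grid_affine T2 ->
  grid_affine (fun x => T1 x + T2 x).
Proof.
move=> a1 a2 k x lam y s1 sx.
rewrite -(a1 _ _ _ _ s1 sx) -(a2 _ _ _ _ s1 sx) -big_split /=.
by apply: eq_bigr => i _; rewrite mulrDr.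
Qed.

Lemma grid_affineZ (c : R) T : grid_affine T -> grid_affine (fun x => c * T x).
Proof.
move=> aT k x lam y s1 sx; rewrite -(aT _ _ _ _ s1 sx) mulr_sumr.
by apply: eq_bigr => i _; rewrite mulrCA.
Qed.

Lemma grid_affine_sum (I : finType) (F : I -> grid n d -> R) :
  (forall i, grid_affine (F i)) -> grid_affine (fun x => \sum_i F i x).
Proof.
move=> aF k x lam y s1 sx.
rewrite -(eq_bigr _ (fun i _ => aF i _ _ _ _ s1 sx)) exchange_big /=.
by apply: eq_bigr => i _; rewrite mulr_sumr.
Qed.

(** A convex combination passes through the affine support [T] at [y], and [T] lies below [f] at
    each point of the combination. *)
Lemma supported_convex f :
  (forall y, exists T, [/\ grid_affine T, T y = f y & forall x, T x <= f x]) ->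
  grid_convex f.
Proof.
move=> supp k x lam y lam_ge0 s1 sx; have [T [aT <- leT]] := supp y.
rewrite -(aT _ _ _ _ s1 sx); apply: ler_sum => i _.
exact: ler_wpM2l.
Qed.

Lemma convex_midpoint h a y b : grid_convex h ->
  (forall j, a j + b j = (y j).*2)%N -> 2 * h y <= h a + h b.
Proof.
move=> hconv mid.
have := hconv 2%N (fun i => if i == ord0 then a else b) (fun=> 2^-1) y.
rewrite !big_ord_recl !big_ord0 /= !addr0 => leh.
suff: h y <= 2^-1 * h a + 2^-1 * h b by clear leh; lra.
apply: leh => [i||j]; first by rewrite invr_ge0.
  by rewrite -[in RHS](mulVf (x := 2)) ?pnatr_eq0 // mulr_natr mulr2n.
rewrite !big_ord_recl !big_ord0 /= addr0.
by have := congr1 (fun k => k%:R : R) (mid j); rewrite -muln2 natrD natrM; lra.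
Qed.

End GridConvexity.

Lemma divn_shift (p t t' : nat) (c : int) :
  (0 < p)%N -> `|c|%N = p -> t%:Z = t'%:Z + c -> (p <= t')%N ->
  (t %/ p = t' %/ p + (0 < c)%R - (c < 0)%R)%N.
Proof.
move=> p_gt0 cE tE le_p; case: (ltrgt0P c) => c0; [| | by lia].
  have -> : t = (t' + p)%N by lia.
  by rewrite divnDr ?dvdnn // divnn p_gt0 subn0.
have -> : t' = (t + p)%N by lia.
by rewrite divnDr ?dvdnn // divnn p_gt0 addn0 addnK.
Qed.

Section Blocks.
Variables (R : realType) (n d : nat) (i0 : 'I_d) (v : 'I_d -> int).
Implicit Types (x y a b : grid n d).

Let p := `|v i0|%N.
Let W := (3 * p)%N.

(** The 2x2 minors of the pair [v], [x] on coordinates [i0] and [i]: constant along lines of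
    direction [v], they determine the line when [v i0] is nonzero. *)
Definition cross x (i : 'I_d) : int :=
  v i0 * (x i : nat)%:Z - v i * (x i0 : nat)%:Z.

Definition window x : nat := (x i0 %/ W)%N.

Definition block x : {set grid n d} :=
  finset (fun y => [forall i, cross y i == cross x i] && (window y == window x)).

Lemma blockP x y :
  reflect ((forall i, cross x i = cross y i) /\ window x = window y)
          (block x == block y).
Proof.
apply: (iffP eqP) => [eqb | [eqc eqw]].
  have: x \in block y by rewrite -eqb inE eqxx andbT; apply/forallP => i.
  rewrite inE => /andP[/forallP eqc /eqP eqw].
  by split=> // i; apply/eqP.
apply/setP => z; rewrite !inE eqw; congr (_ && _).
by apply: eq_forallb => i; rewrite eqc.
Qed.

(** A window splits into three intervals of length [p]; central points lie in the middle one. *)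
Definition central x : bool := ((x i0 %/ p) %% 3 == 1)%N.

(* The window term is [max_b (b (2 t + 1) - W b (b + 1))] with [t = x i0]: its
   breakpoints lie at the half-integers [b W - 1/2], hence it is affine on every
   window and exceeds the affine pieces of the other windows by at least 1. *)
Definition base_piece (b : nat) x : int :=
  b%:Z * (2 * (x i0 : nat)%:Z + 1) - W%:Z * (b%:Z * (b%:Z + 1)).

Definition base_int x : int :=
  \sum_i cross x i ^+ 2 + base_piece (window x) x.

(** Each square is replaced by its tangent at [y], and the window term by its affine piece at
    [y]. *)
Definition tangent_int y x : int :=
  \sum_i (2 * cross y i * cross x i - cross y i ^+ 2) +
  base_piece (window y) x.

Lemma tangent_int_diag y : tangent_int y y = base_int y.
Proof. by congr (_ + _); apply: eq_bigr => i _; ring. Qed.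

Hypothesis p_gt0 : (0 < p)%N.

Lemma base_piece_le (b : nat) x :
  base_piece b x + (b != window x)%:R <= base_piece (window x) x.
Proof.
rewrite /base_piece /window.
set t : nat := x i0; set w := (t %/ W)%N.
have W_gt0 : (0 < W)%N by rewrite muln_gt0.
have lew : (w * W <= t)%N by exact: leq_trunc_div.
have ltw : (t < w.+1 * W)%N by rewrite ltn_ceil.
rewrite -subr_ge0.
(* The difference of the two pieces factors; as [w W <= t < (w + 1) W], for [b != w] both factors
   have the same sign and absolute value at least 1. *)
suff: (b != w)%:R <= (w%:Z - b%:Z) * (2 * t%:Z + 1 - W%:Z * (w%:Z + b%:Z + 1)).
  by lia.
case: (ltngtP b w) => [ltbw|ltwb|->] /=; last by rewrite subrr mul0r.
  have : 1 <= w%:Z - b%:Z by lia.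
  have : 1 <= 2 * t%:Z + 1 - W%:Z * (w%:Z + b%:Z + 1) by nia.
  by nia.
have : 1 <= b%:Z - w%:Z by lia.
have : 2 * t%:Z + 1 - W%:Z * (w%:Z + b%:Z + 1) <= -1 by nia.
by nia.
Qed.

(** Points of different blocks differ in some minor, where the square of a nonzero integer is at
    least 1, or in the window, where [base_piece_le] gives the gap 1. *)
Lemma tangent_int_le y x :
  tangent_int y x + (block x != block y)%:R <= base_int x.
Proof.
have leS : \sum_i (2 * cross y i * cross x i - cross y i ^+ 2) +
    (~~ [forall i, cross x i == cross y i])%:R <= \sum_i cross x i ^+ 2.
  rewrite -lerBrDl -sumrB.
  rewrite [leRHS](eq_bigr (fun i => (cross x i - cross y i) ^+ 2)); last first.
    by move=> i _; ring.
  case: (boolP [forall i, _]) => [_ | /forallPn[i ne_i]] /=.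
    by apply: sumr_ge0 => i _; exact: sqr_ge0.
  rewrite (bigD1 i) //=.
  have: 0 <= \sum_(j | j != i) (cross x j - cross y j) ^+ 2.
    by apply: sumr_ge0 => j _; exact: sqr_ge0.
  by move: ne_i; set S := \sum_(j | _) _; move: S (cross x i) (cross y i); nia.
have leP := base_piece_le (window y) x.
rewrite /tangent_int /base_int.
have : ((block x != block y) <= (~~ [forall i, cross x i == cross y i])
         + (window y != window x))%N.
  case: (boolP [forall i, _]) => [/forallP eqc | _] /=; last by case: eqP.
  have [eqw | _] := eqVneq (window y) (window x); last by case: eqP.
  by rewrite (_ : block x == block y) //; apply/blockP; split=> // i; apply/eqP.
by move: leS leP; do !case: (_ == _); do !case: [forall _, _] => /=; lia.
Qed.

Definition base x : R := (base_int x)%:~R.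

Lemma tangent_affine y : grid_affine (fun x => (tangent_int y x)%:~R : R).
Proof.
have aff_ext (S T : grid n d -> R) : S =1 T -> grid_affine S -> grid_affine T.
  move=> eqST aS k x lam z s1 sx; rewrite -eqST -(aS _ _ _ _ s1 sx).
  by apply: eq_bigr => i _; rewrite eqST.
pose c i := 2 * cross y i.
apply: (@aff_ext (fun x =>
   (\sum_i ((c i * v i0)%:~R * (x i : nat)%:R
            + ((- (c i * v i))%:~R * (x i0 : nat)%:R + (- cross y i ^+ 2)%:~R)))
   + (((window y)%:Z * 2)%:~R * (x i0 : nat)%:R
      + ((window y)%:Z - W%:Z * ((window y)%:Z * ((window y)%:Z + 1)))%:~R))).
  move=> x /=; rewrite /tangent_int [RHS]intrD.
  rewrite (big_morph _ (@intrD R) (mulr0z 1)); congr (_ + _).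
    apply: eq_bigr => i _; rewrite !pmulrn -!intrM -!intrD; congr (_%:~R).
    by rewrite /c /cross; ring.
  rewrite !pmulrn -!intrM -!intrD; congr (_%:~R).
  by rewrite /base_piece; ring.
apply: grid_affineD.
  apply: grid_affine_sum => i; apply: grid_affineD.
    by apply: grid_affineZ; exact: grid_affine_coord.
  apply: grid_affineD; last exact: grid_affine_cst.
  by apply: grid_affineZ; exact: grid_affine_coord.
apply: grid_affineD; last exact: grid_affine_cst.
by apply: grid_affineZ; exact: grid_affine_coord.
Qed.

(** The tangent at [y] raised by [g (block y)] still supports: two values of [g] differ by at most
    1, which the gap between blocks absorbs. *)
Lemma block_perturbation_convex (g : {set grid n d} -> R) :
  (forall B, 0 <= g B <= 1) -> grid_convex (fun x => base x + g (block x)).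
Proof.
move=> g01; apply: supported_convex => y.
exists (fun x => (tangent_int y x)%:~R + g (block y)); split.
- by apply: grid_affineD; [exact: tangent_affine | exact: grid_affine_cst].
- by rewrite tangent_int_diag.
move=> x; have := tangent_int_le y x.
rewrite -(ler_int R) intrD -/(base x).
have /andP[y0 y1] := g01 (block y); have /andP[x0 x1] := g01 (block x).
have [-> | _] := eqVneq (block x) (block y); first by rewrite /=; lra.
by rewrite /=; lra.
Qed.

Definition inner y := [forall i, (`|v i| <= y i) && (y i + `|v i| < n)]%N.

Definition complete := finset (fun y => central y && inner y).

(** The witnesses are [y + v] and [y - v]. A step of [v] moves coordinate [i0] by exactly [p], from
    the middle third of the window to an outer third, and leaves the minors unchanged. *)
Lemma complete_neighbours y : y \in complete ->
  exists a b, [/\ forall j, (a j + b j = (y j).*2)%N,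
    block a = block y /\ block b = block y,
    ~~ central a /\ ~~ central b & base a + base b = 2 * base y].
Proof.
rewrite inE => /andP[cy /forallP iny].
have sgnE (s : int) : `|s| = 1 -> s = 1 \/ s = -1 by lia.
have ltF (s : int) i : `|s| = 1 -> (absz ((y i : nat)%:Z + s * v i)%R < n)%N.
  by move=> /sgnE[->|->]; have := iny i; lia.
have absE (s : int) i : `|s| = 1 ->
    (absz ((y i : nat)%:Z + s * v i)%R)%:Z = (y i : nat)%:Z + s * v i.
  by move=> /sgnE[->|->]; have := iny i; lia.
have n1 : `|1| = 1 :> int by [].
have nN1 : `|-1| = 1 :> int by [].
pose pt s (s1 : `|s| = 1 :> int) : grid n d := [ffun i => Ordinal (ltF s i s1)].
have ptE s s1 i : (pt s s1 i : nat)%:Z = (y i : nat)%:Z + s * v i.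
  by rewrite ffunE; exact: absE.
have crossE s s1 i : cross (pt s s1) i = cross y i.
  by rewrite /cross !ptE; ring.
have divE s s1 :
    (pt s s1 i0 %/ p = (y i0 %/ p) + (0 < s * v i0)%R - (s * v i0 < 0)%R)%N.
  have /andP[le_p _] := iny i0.
  apply: divn_shift; rewrite ?ptE //.
  by rewrite abszM; case: (sgnE s s1) => ->; rewrite ?mul1n.
have windowE s s1 : window (pt s s1) = window y.
  rewrite /window /W mulnC !divnMA divE; move: cy; rewrite /central.
  move: (y i0 %/ p)%N => k.
  by case: (ltrgt0P (s * v i0)) => _; lia.
have centralN s s1 : ~~ central (pt s s1).
  rewrite /central divE; move: cy; rewrite /central.
  have : s * v i0 != 0 by rewrite mulf_neq0 //; lia.
  move: (y i0 %/ p)%N => k.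
  by case: (ltrgt0P (s * v i0)) => // _ _; lia.
have blockE s s1 : block (pt s s1) = block y by apply/eqP/blockP; split.
exists (pt 1 n1), (pt (-1) nN1); split=> //.
  by move=> j; have := ptE 1 n1 j; have := ptE (-1) nN1 j; lia.
rewrite /base /base_int !windowE.
under eq_bigr do rewrite crossE.
under [X in (_ + (X + _)%:~R)]eq_bigr do rewrite crossE.
rewrite -intrD -(intrM _ 2) /base_piece !ptE; congr (_%:~R).
by ring.
Qed.

Variable i1 : 'I_d.
Hypothesis v_coprime : coprime `|v i0|%N `|v i1|%N.

(** Equal minors make [y - x] parallel to [v]; coprimality makes the factor an integer, and the
    window length [3 p] keeps it below 3 in absolute value. *)
Lemma same_block_multiple x y : block x = block y ->
  exists2 t : int, (`|t| <= 2)%N & forall i, (y i : nat)%:Z = (x i : nat)%:Z + t * v i.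
Proof.
move=> /eqP/blockP[eqc eqw].
have eqi i : v i0 * ((y i : nat)%:Z - (x i : nat)%:Z)
           = v i * ((y i0 : nat)%:Z - (x i0 : nat)%:Z).
  by have := eqc i; rewrite /cross; lia.
have /dvdzP[t tE] : (v i0 %| (y i0 : nat)%:Z - (x i0 : nat)%:Z)%Z.
  by rewrite -(@Gauss_dvdzr _ (v i1)) // -eqi dvdz_mulr.
have v0 : v i0 != 0 by lia.
exists t => [|i]; last first.
  have : v i0 * ((y i : nat)%:Z - (x i : nat)%:Z - t * v i) = 0.
    by rewrite mulrBr eqi tE; ring.
  by move/eqP; rewrite mulf_eq0 (negPf v0) /=; lia.
have W_gt0 : (0 < W)%N by rewrite muln_gt0.
have := leq_trunc_div (x i0) W; have := ltn_ceil (x i0) W_gt0.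
have := leq_trunc_div (y i0) W; have := ltn_ceil (y i0) W_gt0.
move: eqw; rewrite /window => -> y1 y2 x1 x2.
have ltW : (absz (t * v i0)%R < W)%N by rewrite -tE; lia.
by move: ltW; rewrite abszM /W -/p ltn_pmul2r // ltnS.
Qed.

(** Two central points of one window lie in the same third, so their [i0] coordinates differ by less
    than [p] and the multiple of [v] between them is zero. *)
Lemma complete_block_inj : {in complete &, injective block}.
Proof.
move=> x y; rewrite !inE => /andP[cx _] /andP[cy _] eqb.
have [t _ tE] := same_block_multiple eqb.
have /eqP/blockP[_ eqw] := eqb.
have eqq : (x i0 %/ p = y i0 %/ p)%N.
  by move: eqw cx cy; rewrite /window /central /W mulnC !divnMA; lia.
have := leq_trunc_div (x i0) p; have := ltn_ceil (x i0) p_gt0.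
have := leq_trunc_div (y i0) p; have := ltn_ceil (y i0) p_gt0.
rewrite eqq => y1 y2 x1 x2.
have ltp : (absz (t * v i0)%R < p)%N by have := tE i0; lia.
have t0 : t = 0.
  by move: ltp; rewrite abszM -/p -[ltnRHS]mul1n ltn_pmul2r //; lia.
apply/ffunP => i; apply/val_inj; have := tE i.
by rewrite t0 mul0r addr0 => -[].
Qed.

End Blocks.

(** One value of a uniformly random function is uniform, cleared of denominators. It serves both for
    random seeds and for random grid points. *)
Lemma card_ffun_coord (aT rT : finType) (i : aT) (S : {pred rT}) :
  (#|finset (fun f : {ffun aT -> rT} => f i \in S)| * #|rT|
   = #|S| * #|{ffun aT -> rT}|)%N.
Proof.
pose F (j : aT) : pred rT := fun t => (j == i) ==> (t \in S).
have -> : #|finset (fun f : {ffun aT -> rT} => f i \in S)| = #|family F|.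
  apply: eq_card => f; rewrite inE; apply/idP/familyP => [fi j | /(_ i)].
    by rewrite unfold_in; apply/implyP => /eqP ->.
  by rewrite unfold_in eqxx.
rewrite card_family foldrE big_image /= (bigD1 i) //=.
have -> : #|F i| = #|S| by apply: eq_card => t; rewrite unfold_in eqxx.
rewrite (eq_bigr (fun=> #|rT|)) => [|j /negPf ne_j]; last first.
  by apply: eq_card => t; rewrite unfold_in ne_j.
rewrite prod_nat_const card_ffun -mulnA -expnSr; congr (_ * #|rT| ^ _)%N.
by rewrite (cardC1 i) prednK //; apply/card_gt0P; exists i.
Qed.

(** * The convex and the far instances *)

Section HardPair.
Variables (R : realType) (n d : nat) (i0 i1 : 'I_d) (v : 'I_d -> int).
Implicit Types (x y : grid n d).

Let blk : grid n d -> {set grid n d} := block i0 v.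
Let compl : {set grid n d} := complete n i0 v.
Let seed := {ffun {set grid n d} -> 'Z_60}.
Implicit Types u : seed.

Definition yes_fun u x : R := base R i0 v x + (u (blk x) : nat)%:R / 60.

(** The inner addition is in ['Z_60]: the shift raises a central value by 1/60, except that seed 59
    wraps to 0. *)
Definition no_fun u x : R :=
  base R i0 v x + ((u (blk x) + (central i0 v x)%:R)%R : nat)%:R / 60.

Definition wrapped u : {set grid n d} :=
  finset (fun y => (y \in compl) && (u (blk y) == -1)).

Lemma sum_wrapped : (60 * (\sum_u #|wrapped u|) = #|compl| * #|{: seed}|)%N.
Proof.
under eq_bigr do rewrite -sum1_card.
under eq_bigr do (under eq_bigl do rewrite inE).
rewrite (exchange_big_dep (mem compl)) /=; last by move=> u y _ /andP[].
rewrite -sum_nat_const big_distrr /=; apply: eq_bigr => y yC.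
have := card_ffun_coord (blk y) (pred1 (-1 : 'Z_60)).
rewrite card1 mul1n card_ord => <-; rewrite mulnC; congr (_ * _)%N.
by rewrite -sum1_card; apply: eq_bigl => u; rewrite yC !inE.
Qed.

(** Markov's inequality: on average 1/60 of the centres wrap, so more than 1/10 of them wrap for at
    most 1/6 of the seeds. *)
Lemma card_many_wrapped :
  (6 * #|finset (fun u => (#|compl| < 10 * #|wrapped u|)%N)| <= #|{: seed}|)%N.
Proof.
set bad := finset _.
have [C0 | C_gt0] := posnP #|compl|.
  rewrite (_ : #|bad| = 0)%N // eq_card0 // => u; rewrite !inE C0.
  rewrite (_ : #|wrapped u| = 0)%N //; apply/eqP; rewrite -leqn0 -C0.
  by apply/subset_leq_card/fintype.subsetP => y; rewrite inE => /andP[].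
rewrite -(leq_pmul2l C_gt0) -sum_wrapped.
have : (#|bad| * #|compl| <= \sum_u 10 * #|wrapped u|)%N.
  rewrite -sum_nat_const big_mkcond; apply: leq_sum => u _.
  by case: ifP; rewrite ?inE // => /ltnW.
by rewrite -big_distrr /=; lia.
Qed.

Hypothesis v0_gt0 : (0 < `|v i0|)%N.

Lemma yes_fun_convex u : grid_convex (yes_fun u).
Proof.
apply: (@block_perturbation_convex _ _ _ _ _ v0_gt0 (fun B => (u B : nat)%:R / 60)).
move=> B; rewrite divr_ge0 ?ler0n //= ler_pdivrMr ?ltr0n // mul1r ler_nat.
by apply: ltnW; exact: ltn_ord (u B).
Qed.

Hypothesis v_coprime : coprime `|v i0|%N `|v i1|%N.

Lemma Zp60_succ (c : 'Z_60) : c != -1 -> ((c + 1)%R : nat) = (c : nat).+1.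
Proof.
move=> cN1; have c_lt : (c < 60)%N := ltn_ord c.
rewrite /= -[(1 %% _)%N]/1%N addn1; apply: modn_small.
suff: ((c : nat).+1 < 60)%N by []; rewrite ltn_neqAle c_lt andbT.
by apply: contraNneq cN1 => -[cE]; apply/eqP/val_inj; rewrite /= cE.
Qed.

(** Along [y - v], [y], [y + v] the unshifted instance is affine, so an unwrapped shift puts the
    middle value above the average of the outer ones; a convex [h] must differ at one of the
    three. *)
Lemma no_fun_violation u (h : grid n d -> R) y : grid_convex h ->
  y \in compl -> u (blk y) != -1 ->
  exists2 z, blk z = blk y & no_fun u z != h z.
Proof.
move=> hconv yC uy.
have cy : central i0 v y by move: yC; rewrite inE => /andP[].
have [a [b [midab [ba bb] [/negPf ca /negPf cb] base_ab]]] :=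
  complete_neighbours R v0_gt0 yC.
have le_h := convex_midpoint hconv midab.
have [eqa|ne] := eqVneq (no_fun u a) (h a); last by exists a.
have [eqb|ne] := eqVneq (no_fun u b) (h b); last by exists b.
have [eqy|ne] := eqVneq (no_fun u y) (h y); last by exists y.
exfalso; move: le_h; rewrite -eqa -eqb -eqy /no_fun /blk ba bb ca cb cy -/blk.
rewrite addr0 -[true%:R]/(1 : 'Z_60) Zp60_succ //.
by lra.
Qed.

Lemma no_fun_far u (eps : R) : eps <= 1 / 10 ->
  (10 * #|wrapped u| <= #|compl|)%N -> (n ^ d <= 9 * #|compl|)%N ->
  eps_far eps (no_fun u).
Proof.
move=> eps_le few_wrapped many_compl h hconv.
pose good := compl :\: wrapped u.
pose diff : {set grid n d} := finset (fun x => no_fun u x != h x).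
have -> : #|[set x | no_fun u x != h x]%classic| = #|diff|.
  by apply: eq_card => x; rewrite [RHS]inE; apply/idP/idP; rewrite in_setE.
have -> : #|[set: grid n d]%classic| = (n ^ d)%N.
  rewrite (_ : #|_| = #|{: grid n d}|); first by rewrite card_ffun !card_ord.
  by apply: eq_card => x; rewrite in_setT.
(* Each unwrapped centre forces a change inside its own block, and distinct centres have distinct
   blocks. *)
have good_diff : (#|good| <= #|diff|)%N.
  have inj : {in good &, injective blk}.
    move=> x y /setDP[xC _] /setDP[yC _].
    exact: (complete_block_inj v0_gt0 v_coprime xC yC).
  rewrite -(card_in_imset inj); apply: leq_trans (leq_imset_card blk diff).
  apply/subset_leq_card/fintype.subsetP => _ /imsetP[y /setDP[yC yW] ->].
  have uy : u (blk y) != -1 by move: yW; rewrite inE yC.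
  have [z <- zh] := no_fun_violation hconv yC uy.
  by apply: imset_f; rewrite inE.
have cardC : (#|good| + #|wrapped u| = #|compl|)%N.
  rewrite -(cardsID (wrapped u) compl) addnC; congr (_ + _)%N.
  by apply: eq_card => y; rewrite !inE andbA andbb.
(* At least 9/10 of the centres are unwrapped, and centres make up at least 1/9 of the grid. *)
have : (n ^ d <= 10 * #|diff|)%N by lia.
rewrite -(ler_nat R) natrM => le_diff.
have : eps * (n ^ d)%:R <= 1 / 10 * (n ^ d)%:R by rewrite ler_wpM2r.
by lra.
Qed.

End HardPair.

(** * Density of complete blocks *)

Section CompleteBlocks.
Variables (n d : nat) (i0 : 'I_d) (v : 'I_d -> int).
Hypothesis n_gt0 : (0 < n)%N.
Hypothesis v_small : (3 * \sum_i `|v i| <= n)%N.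
Hypothesis v0_gt0 : (0 < `|v i0|)%N.

Let inn : {set grid n d} := finset (fun x => inner v x).

Lemma card_near_boundary (a : nat) :
  (#|[pred t : 'I_n | (t < a) || (n <= t + a)]| <= 2 * a)%N.
Proof.
rewrite cardE -(size_map val).
rewrite (_ : (2 * a)%N = size (iota 0 a ++ iota (n - a) a)); last first.
  by rewrite size_cat !size_iota mul2n addnn.
apply: uniq_leq_size; first by rewrite map_inj_uniq ?enum_uniq //; exact: val_inj.
move=> _ /mapP[t t_in ->]; move: t_in; rewrite mem_enum inE mem_cat !mem_iota /=.
by have := ltn_ord t; lia.
Qed.

(** Union bound: coordinate [i] fails on at most a fraction [2 |v i| / n] of the grid, and these
    fractions sum to at most 2/3. *)
Lemma card_inner : (n ^ d <= 3 * #|inn|)%N.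
Proof.
have cardG : #|{: grid n d}| = (n ^ d)%N by rewrite card_ffun !card_ord.
pose out i : {set grid n d} := finset (fun x : grid n d =>
  x i \in [pred t : 'I_n | (t < `|v i|) || (n <= t + `|v i|)]%N).
have cover : ~: inn \subset \bigcup_i out i.
  apply/fintype.subsetP => x; rewrite !inE => /forallPn[i xi].
  apply/finset.bigcupP; exists i => //; rewrite !inE; move: xi.
  by rewrite negb_and -leqNgt -ltnNge.
have card_out i : (#|out i| * n <= 2 * `|v i| * n ^ d)%N.
  have := card_ffun_coord i [pred t : 'I_n | (t < `|v i|) || (n <= t + `|v i|)]%N.
  rewrite -/(grid n d) -/(out i) cardG card_ord => ->.
  by rewrite leq_mul2r card_near_boundary orbT.
have : (#|~: inn| * n <= (2 * \sum_i `|v i|) * n ^ d)%N.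
  apply: (@leq_trans ((\sum_i #|out i|) * n)%N).
    rewrite leq_mul2r; apply/orP; right.
    apply: leq_trans (subset_leq_card cover) _.
    elim/big_ind2: _ => [|A k B l leA leB|//]; first by rewrite cards0.
    by rewrite cardsU; lia.
  rewrite big_distrl big_distrr big_distrl /=.
  by apply: leq_sum => i _; exact: card_out.
have := cardsC inn; rewrite cardG.
move: v_small n_gt0; set s := (\sum_i _)%N.
move: (n ^ d)%N #|inn| #|~: inn| => N a b s_small n0 <- le_b.
have : (3 * b <= 2 * (a + b))%N.
  rewrite -(leq_pmul2r n0) -mulnA; apply: (@leq_trans (3 * (2 * s * (a + b)))%N).
    by rewrite leq_mul2l le_b.
  by nia.
by lia.
Qed.

Lemma card_complete : (n ^ d <= 9 * #|complete n i0 v|)%N.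
Proof.
suff: (#|inn| <= #|complete n i0 v| * 3)%N by have := card_inner; lia.
pose p := `|v i0|%N.
(* Lowering coordinate [i0] by [r x] steps of length [p] brings an inner point to a central one that
   is still inner; as [r x] takes three values, the map [low] is at most 3-to-1. *)
pose r (x : grid n d) := ((x i0 %/ p).-1 %% 3)%N.
pose low (x : grid n d) : grid n d :=
  [ffun i => if i == i0 then insubd (x i0) (x i0 - r x * p)%N else x i].
have low0 x : (low x i0 : nat) = (x i0 - r x * p)%N.
  rewrite ffunE eqxx val_insubd ifT //.
  by apply: leq_ltn_trans (ltn_ord (x i0)); exact: leq_subr.
have innP x : x \in inn -> [/\ (p <= x i0)%N, (0 < x i0 %/ p)%N
    & (r x * p <= x i0 - p)%N].
  rewrite inE => /forallP/(_ i0)/andP[le_p _]; split=> //.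
    by rewrite divn_gt0.
  have : (r x <= (x i0 %/ p).-1)%N by exact: leq_mod.
  have := leq_trunc_div (x i0) p.
  by have : (0 < x i0 %/ p)%N := etrans (divn_gt0 _ v0_gt0) le_p; nia.
have inj : {in inn &, injective (fun x => (low x, inord (r x) : 'I_3))}.
  move=> x y xI yI [/ffunP eq_low /(congr1 val)].
  rewrite /= !inordK ?ltn_pmod // => eq_r.
  have [_ _ xr] := innP x xI; have [_ _ yr] := innP y yI.
  apply/ffunP => i; have := eq_low i; have [-> _|ne_i] := eqVneq i i0; last first.
    by rewrite !ffunE (negPf ne_i).
  have : (low x i0 : nat) = low y i0 by rewrite (eq_low i0).
  rewrite !low0 -eq_r => eq0; move: yr; rewrite -eq_r => yr.
  have sub_inj (a b k : nat) :
    (k <= a - p -> k <= b - p -> a - k = b - k -> a = b)%N by lia.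
  exact: ord_inj (sub_inj _ _ _ xr yr eq0).
rewrite -(card_in_imset inj).
apply: (@leq_trans #|finset.setX (complete n i0 v) [set: 'I_3]%SET|); last first.
  by rewrite cardsX cardsT card_ord.
apply/subset_leq_card/fintype.subsetP => _ /imsetP[x xI ->].
rewrite !inE andbT; have [le_p q_gt0 le_r] := innP x xI.
apply/andP; split.
  rewrite /central -/p low0.
  have : (r x + (x i0 - r x * p) %/ p = x i0 %/ p)%N.
    by rewrite -divnMDl // subnKC //; apply: leq_trans le_r (leq_subr _ _).
  rewrite /r; move: (x i0 %/ p)%N q_gt0 => k.
  by move: ((x i0 - _) %/ p)%N => l; lia.
apply/forallP => i; have := xI; rewrite inE => /forallP/(_ i).
have [-> |ne_i] := eqVneq i i0; last by rewrite ffunE (negPf ne_i).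
by rewrite low0 -/p; lia.
Qed.

End CompleteBlocks.

(** * Counting directions *)

(** The sum of [1 / m^2] for [m] from 2 to [k] is at most [3/4 - 1/k], by induction from
    [1 / (k + 1)^2 <= 1/k - 1/(k + 1)]. *)
Lemma sum_inverse_square_le (a k : nat) (b : nat -> nat) : (2 <= k)%N ->
  (forall m, 2 <= m -> b m * m ^ 2 <= a)%N ->
  (4 * \sum_(2 <= m < k.+1) b m <= 3 * a)%N.
Proof.
move=> k2 b_le; suff: (4 * k * (\sum_(2 <= m < k.+1) b m) + 4 * a <= 3 * k * a)%N.
  by move: (\sum_(_ <= _ < _) _)%N => S; nia.
elim: k k2 => // k IHk; rewrite leq_eqVlt => /orP[/eqP <-|k2].
  by rewrite big_nat1; have := b_le 2%N isT; lia.
rewrite big_nat_recr /=; last by lia.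
move: (IHk k2) (b_le k.+1 (ltnW k2)).
move: (\sum_(_ <= _ < _) _)%N (b k.+1) => S c IH le_a.
rewrite -(@leq_pmul2l k); last by lia.
have : (k * k.+1 * c <= a)%N by nia.
by have := leq_mul (leqnn k.+1) IH; lia.
Qed.

Section Directions.
Variables (n d : nat) (i0 i1 : 'I_d).

(* An integer vector with entries in [-n, n] is stored with its entries shifted
   by n. *)
Let code := {ffun 'I_d -> 'I_(n.*2).+1}.
Implicit Types w : code.

Definition vec w (i : 'I_d) : int := (w i : nat)%:Z - n%:Z.

Lemma vec_inj w w' : vec w =1 vec w' -> w = w'.
Proof.
move=> eqv; apply/ffunP => i; apply: ord_inj.
by have := eqv i; rewrite /vec => /addIr[].
Qed.

Definition short_vecs : {set code} := finset (fun w =>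
  [&& vec w i0 != 0, vec w i1 != 0 & 3 * (\sum_i `|vec w i|) <= n]%N).

Definition directions : {set code} :=
  finset (fun w => (w \in short_vecs) && coprime `|vec w i0|%N `|vec w i1|%N).

(** The binomial coefficient counts the [j]-tuples of naturals with sum at most [2 s - j]; a zigzag
    coding of the integers maps them injectively to short vectors. *)
Lemma card_short_vecs_ge (s j : nat) : i0 = 0%N :> nat -> i1 = 1%N :> nat ->
  (2 <= j <= d)%N -> (j <= s.*2)%N -> (3 * s.+1 <= n)%N ->
  ('C(s.*2, j) <= #|short_vecs|)%N.
Proof.
move=> i0E i1E /andP[j2 jd] js sn; pose T := (s.*2 - j)%N.
have -> : 'C(s.*2, j) = 'C(j + T, j) by rewrite subnKC.
rewrite -card_partial_ord_partitions; set tup := finset _.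
pose tau (t : j.-tuple 'I_T.+1) i := nth 0%N (map val t) i.
have tau_le t i : (tau t i <= T)%N.
  have [lt_i|le_i] := ltnP i j.
    by rewrite /tau (nth_map ord0) ?size_tuple // -ltnS ltn_ord.
  by rewrite /tau nth_default // size_map size_tuple.
(* A zigzag enumeration of the integers, starting at +-1 for the entries i0 and i1
   and at 0 for the others: the entry number k has absolute value at most
   (k + 2) / 2, resp. (k + 1) / 2. *)
pose zz (i k : nat) : nat := (if i < 2 then
    if odd k then n - k./2.+1 else n + k./2.+1
  else if odd k then n - uphalf k else n + k./2)%N.
pose F (t : j.-tuple 'I_T.+1) : code :=
  [ffun i : 'I_d => inord (if (i < j)%N then zz i (tau t i) else n)].
have Fi t i : (F t i : nat) = (if (i < j)%N then zz i (tau t i) else n).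
  rewrite ffunE inordK //; case: ifP => _; last by lia.
  by rewrite /zz; have := tau_le t i; rewrite /T; do !case: ifP => _; lia.
have inj : {in tup &, injective F}.
  move=> t t' _ _ eqF; apply: val_inj; apply: (inj_map val_inj).
  apply: (@eq_from_nth _ 0%N) => [|i]; rewrite !size_map !size_tuple // => ltij.
  have lt_id : (i < d)%N by exact: leq_trans ltij jd.
  have := Fi t (Ordinal lt_id); rewrite eqF Fi /= ltij -/(tau t i) -/(tau t' i).
  have := tau_le t i; have := tau_le t' i; rewrite /zz /T.
  move: (tau t i) (tau t' i) => k k' le_k le_k'.
  by case: ifP => _; case: ifP => ?; case: ifP => ?; lia.
rewrite -(card_in_imset inj); apply/subset_leq_card/fintype.subsetP.
move=> _ /imsetP[t + ->]; rewrite inE => sum_t.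
have vec_le (i : 'I_d) :
    (2 * `|vec (F t) i| <= (if i < j then (tau t i).+1 else 0) + (i < 2))%N.
  rewrite /vec Fi; case: ifP => _; last by lia.
  by rewrite /zz; have := tau_le t i; rewrite /T; do !case: ifP => ?; lia.
have nz (i : 'I_d) : (i < 2)%N -> vec (F t) i != 0.
  move=> i2; rewrite /vec Fi ifT; last by lia.
  by rewrite /zz i2; have := tau_le t i; rewrite /T; case: ifP => ?; lia.
rewrite inE !nz ?i0E ?i1E //=.
(* The right-hand side is [2 (s + 1)], so the norm is at most [s + 1 <= n / 3]. *)
have : (\sum_i 2 * `|vec (F t) i| <= T + j + 2)%N.
  apply: leq_trans (leq_sum _ _) _ => [i _|]; first exact: vec_le.
  rewrite big_split /=.
  rewrite -(big_mkord predT (fun i => if i < j then (tau t i).+1 else 0)%N).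
  rewrite -(big_mkord predT (fun i => nat_of_bool (i < 2)%N)).
  apply: leq_add.
    rewrite -big_mkcond /= -(big_nat_widen _ _ _ predT) //.
    rewrite (eq_bigr (fun i => tau t i + 1)%N); last by move=> i _; rewrite addn1.
    rewrite big_split /= sum_nat_const_nat muln1 subn0 leq_add2r.
    apply: leq_trans sum_t; rewrite [leqRHS](_ : _ = \sum_(k <- map val t) k)%N.
      by rewrite [leqRHS](big_nth 0%N) size_map size_tuple.
    by rewrite big_map.
  rewrite (@big_cat_nat _ _ _ 2) //=; last by lia.
  have -> : (\sum_(2 <= i < d) (i < 2) = 0)%N.
    rewrite big_nat_cond; apply: big1 => i /andP[/andP[i2 _] _].
    by rewrite ltnNge i2.
  by rewrite !big_nat_recr //= big_nil.
by rewrite -big_distrr /=; move: (\sum_i _)%N => S; rewrite /T; lia.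
Qed.

Hypothesis i01 : i0 != i1.

Let divisible m : {set code} := finset (fun w =>
  [&& w \in short_vecs, m %| `|vec w i0| & m %| `|vec w i1|]%N).

(* Moves the entry stored as a by r towards 0. *)
Let shrink (a r : nat) := (if n < a then a - r else a + r)%N.

Let off (a : nat) : int := a%:Z - n%:Z.

Let shrink_le a r m : (m %| `|off a|)%N -> off a != 0 -> (r < m)%N ->
  [/\ (`|off (shrink a r)| <= `|off a|)%N, off (shrink a r) != 0
    & (a <= n.*2)%N -> (shrink a r <= n.*2)%N].
Proof.
rewrite /shrink /off => /dvdnP[k aE] a0 ltr.
have k_gt0 : (0 < k)%N by case: k aE => //; lia.
have lek : (m <= k * m)%N by rewrite leq_pmull.
by case: ltnP => ?; split; lia.
Qed.

(** From absolute value [k m] one lands in the interval from [(k - 1) m + 1] to [k m]. These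
    intervals are disjoint, and the sign is kept. *)
Let shrink_inj a a' r r' m : (m %| `|off a|)%N -> off a != 0 ->
  (m %| `|off a'|)%N -> off a' != 0 -> (r < m)%N -> (r' < m)%N ->
  shrink a r = shrink a' r' -> a = a' /\ r = r'.
Proof.
rewrite /shrink /off => /dvdnP[k aE] a0 /dvdnP[k' aE'] a0' ltr ltr'.
have k_gt0 : (0 < k)%N by case: k aE => //; lia.
have k'_gt0 : (0 < k')%N by case: k' aE' => //; lia.
have lek : (m <= k * m)%N by rewrite leq_pmull.
have lek' : (m <= k' * m)%N by rewrite leq_pmull.
have step (l l' : nat) : (l < l' -> l * m + m <= l' * m)%N.
  by move=> lt; rewrite -mulSnr leq_mul2r lt orbT.
case: (ltngtP k k') => kk; [have := step _ _ kk | have := step _ _ kk | move: kk];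
  last move=> kk; last (move: aE; rewrite kk => aE);
  by case: ltnP => ?; case: ltnP => ?; lia.
Qed.

(* Shrinking the entries i0 and i1 of a vector divisible by m by any r, s < m is
   injective, since the original entries are recovered by rounding up to m. *)
Lemma card_divisible m : (0 < m)%N -> (#|divisible m| * m ^ 2 <= #|short_vecs|)%N.
Proof.
move=> m_gt0.
pose F (z : code * ('I_m * 'I_m)) : code := [ffun i =>
  if i == i0 then inord (shrink (z.1 i0) z.2.1) else
  if i == i1 then inord (shrink (z.1 i1) z.2.2) else z.1 i].
have divP w : w \in divisible m -> [/\ vec w i0 != 0, vec w i1 != 0,
    (3 * (\sum_i `|vec w i|) <= n)%N, (m %| `|vec w i0|)%N & (m %| `|vec w i1|)%N].
  by rewrite !inE => /and3P[/and3P[-> -> ->] -> ->].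
have le2n (w : code) i : (w i <= n.*2)%N by rewrite -ltnS ltn_ord.
have F0 w r s : w \in divisible m -> F (w, (r, s)) i0 = shrink (w i0) r :> nat.
  case/divP => w0 _ _ m0 _; rewrite ffunE eqxx inordK // ltnS.
  by have [_ _ ->] := shrink_le m0 w0 (ltn_ord r).
have F1 w r s : w \in divisible m -> F (w, (r, s)) i1 = shrink (w i1) s :> nat.
  case/divP => _ w1 _ _ m1; rewrite ffunE eq_sym (negPf i01) eqxx inordK // ltnS.
  by have [_ _ ->] := shrink_le m1 w1 (ltn_ord s).
have F2 w r s i : i != i0 -> i != i1 -> F (w, (r, s)) i = w i.
  by move=> /negPf ni0 /negPf ni1; rewrite ffunE ni0 ni1.
pose D := finset.setX (divisible m) (finset.setX [set: 'I_m]%SET [set: 'I_m]%SET).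
have inj : {in D &, injective F}.
  move=> [w [r s]] [w' [r' s']]; rewrite !finset.in_setX /=.
  move=> /andP[wD _] /andP[wD' _] eqF.
  have [w0 w1 _ m0 m1] := divP w wD; have [w0' w1' _ m0' m1'] := divP w' wD'.
  have := F0 w r s wD; rewrite eqF F0 // => /esym.
  case/(shrink_inj m0 w0 m0' w0' (ltn_ord r) (ltn_ord r')) => eq0 eqr.
  have := F1 w r s wD; rewrite eqF F1 // => /esym.
  case/(shrink_inj m1 w1 m1' w1' (ltn_ord s) (ltn_ord s')) => eq1 eqs.
  congr (_, (_, _)); [apply/ffunP => i | exact: ord_inj | exact: ord_inj].
  have [->|ni0] := eqVneq i i0; first exact: ord_inj.
  have [->|ni1] := eqVneq i i1; first exact: ord_inj.
  by rewrite -(F2 w r s i ni0 ni1) eqF F2.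
have -> : (#|divisible m| * m ^ 2)%N = #|D| by rewrite !cardsX !cardsT !card_ord.
rewrite -(card_in_imset inj); apply/subset_leq_card/fintype.subsetP.
move=> _ /imsetP[[w [r s]] + ->]; rewrite !finset.in_setX /= => /andP[wD _].
have [w0 w1 small m0 m1] := divP w wD.
have [le0 ne0 _] := shrink_le m0 w0 (ltn_ord r).
have [le1 ne1 _] := shrink_le m1 w1 (ltn_ord s).
rewrite inE /vec F0 // F1 // ne0 ne1 /=; apply: leq_trans small.
rewrite leq_mul2l /=; apply: leq_sum => i _; rewrite /vec.
have [->|ni0] := eqVneq i i0; first by rewrite F0.
have [->|ni1] := eqVneq i i1; first by rewrite F1.
by rewrite F2.
Qed.

(** A short vector that is not a direction is divisible by its gcd [m >= 2]; summing the fractions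
    [1 / m^2] discards at most 3/4 of the short vectors. *)
Lemma card_directions : (#|short_vecs| <= 4 * #|directions|)%N.
Proof.
have [n_small | n2] := ltnP n 2.
  rewrite (_ : #|short_vecs| = 0)%N // eq_card0 // => w; rewrite inE.
  apply/negP => /and3P[w0 _]; rewrite (bigD1 i0) //=.
  by move: (\sum_(_ | _) _)%N => S; lia.
have cover : short_vecs :\: directions \subset
    \bigcup_(m < n.+1 | (2 <= m)%N) divisible m.
  apply/fintype.subsetP => w /setDP[wS]; rewrite inE wS /= => ncop.
  have := wS; rewrite inE => /and3P[w0 w1 small].
  pose g := gcdn `|vec w i0| `|vec w i1|.
  have g_gt0 : (0 < g)%N by rewrite gcdn_gt0; lia.
  have g2 : (2 <= g)%N by move: ncop; rewrite /coprime -/g; lia.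
  have g_le : (g < n.+1)%N.
    have : (g <= `|vec w i0|)%N by apply: dvdn_leq; [lia | exact: dvdn_gcdl].
    move: small; rewrite (bigD1 i0) //=.
    by move: (\sum_(_ | _) _)%N => S; lia.
  apply/finset.bigcupP; exists (Ordinal g_le) => //.
  by rewrite inE wS /= dvdn_gcdl dvdn_gcdr.
have le_sum : (#|short_vecs :\: directions| <= \sum_(2 <= m < n.+1) #|divisible m|)%N.
  apply: leq_trans (subset_leq_card cover) _.
  rewrite big_nat_cond (big_nat_widenl _ 0%N) // big_mkord.
  rewrite [leqRHS](eq_bigl (fun m : 'I_n.+1 => (2 <= m)%N)); last first.
    by move=> m; rewrite andbT -andbA; have := ltn_ord m; lia.
  elim/big_ind2: _ => [|A k B l leA leB|//]; first by rewrite cards0.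
  by rewrite cardsU; apply: leq_trans (leq_subr _ _) (leq_add leA leB).
have := sum_inverse_square_le n2 (fun m m2 => card_divisible (ltnW m2)).
have := cardsID directions short_vecs.
have : (#|short_vecs :&: directions| <= #|directions|)%N.
  exact/subset_leq_card/subsetIr.
by lia.
Qed.

End Directions.

(** * Lower bounds on binomial coefficients *)

Lemma central_bin_rec s :
  (s.+1 * 'C(s.+1.*2, s.+1) = 2 * s.*2.+1 * 'C(s.*2, s))%N.
Proof.
have symm : 'C(s.*2.+1, s) = 'C(s.*2.+1, s.+1).
  by rewrite -bin_sub; [congr 'C(_, _); lia | lia].
rewrite doubleS binS symm addnn -mul2n mulnCA -mulnA.
by rewrite -(mul_bin_diag s.*2.+1 s).
Qed.

Lemma central_bin_ge3 s : (0 < s)%N -> (2 * 3 ^ s <= 3 * 'C(s.*2, s))%N.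
Proof.
case: s => // s _; elim: s => // s IHs.
rewrite -(@leq_pmul2l s.+2) //; have := central_bin_rec s.+1.
move: IHs; rewrite (expnS 3 s.+1).
move: (3 ^ s.+1)%N 'C(s.+1.*2, s.+1) 'C(s.+2.*2, s.+2) => a b c IH e.
have -> : (s.+2 * (3 * c) = 3 * (s.+2 * c))%N by lia.
by rewrite e; nia.
Qed.

(** Factor by factor, [(2 d - i) / (2 d) <= (m - i) / m]. *)
Lemma bin_scale m d :
  (d.*2 <= m)%N -> ('C(d.*2, d) * m ^ d <= 'C(m, d) * d.*2 ^ d)%N.
Proof.
move=> le_dm; rewrite -(leq_pmul2r (fact_gt0 d)).
rewrite mulnAC bin_ffact [leqRHS]mulnAC bin_ffact !ffact_prod.
have powE k : (k ^ d = \prod_(i < d) k)%N by rewrite prod_nat_const card_ord.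
rewrite !powE -!big_split /=; apply: leq_prod => i _.
by have := ltn_ord i; nia.
Qed.

Section BinomialBounds.
Variable R : realType.

(** The ratio of consecutive central coefficients is [4 - 2 / (s + 1)], which reaches 18/5 at
    [s = 4]. *)
Lemma central_bin_ge s : (4 <= s)%N ->
  2 / 5 * (18 / 5) ^+ s <= 'C(s.*2, s)%:R :> R.
Proof.
elim: s => // s IHs; rewrite leq_eqVlt => /orP[/eqP <-|s4].
  by rewrite (_ : 'C(_, _) = 70%N) // !exprS expr0; lra.
rewrite -(@ler_pM2l _ s.+1%:R) ?ltr0n // -natrM central_bin_rec natrM exprS.
have := IHs s4; set a := _ ^+ s; set b := 'C(_, _)%:R => IH.
have b_ge0 : 0 <= b by exact: ler0n.
have s4R : 4 <= s%:R :> R by rewrite ler_nat.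
have -> : (2 * s.*2.+1)%:R = 4 * s%:R + 2 :> R.
  have -> : (2 * s.*2.+1 = 4 * s + 2)%N by lia.
  by rewrite natrD natrM.
by rewrite -(natr1 s); nra.
Qed.

(** From [e y <= exp y] at [y = 2 x / 5], with [e >= (7/6)^6 >= 5/2]. *)
Lemma le_expR_two_fifths (x : R) : x <= expR (2 / 5 * x).
Proof.
have [x0|x_gt0] := ltP x 0; first by apply: ltW; rewrite (lt_trans x0) ?expR_gt0.
have e1 : 5 / 2 <= expR (1 : R).
  have -> : expR (1 : R) = expR (6^-1) ^+ 6.
    by rewrite -expRM_natl mulfV // pnatr_eq0.
  have : (7 / 6) ^+ 6 <= expR (6^-1 : R) ^+ 6.
    by apply: lerXn2r; rewrite ?nnegrE ?expR_ge0; have := expR_ge1Dx (6^-1 : R); lra.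
  by apply: le_trans; rewrite !exprS expr0; lra.
have := expR_ge1Dx (2 / 5 * x - 1); rewrite addrCA subrr addr0 => le_x.
rewrite -(subrK 1 (2 / 5 * x)) expRD.
by have := expR_gt0 (2 / 5 * x - 1); nra.
Qed.

Lemma expR_six_fifths : expR (6 / 5 : R) <= 18 / 5.
Proof.
have -> : (6 / 5 : R) = 12%:R * 10^-1 by lra.
rewrite expRM_natl.
have lt1 : 0 < expR (- 10^-1 : R) by exact: expR_gt0.
have : expR (10^-1 : R) <= 10 / 9.
  have := expR_ge1Dx (- 10^-1 : R).
  have : expR (10^-1 : R) * expR (- 10^-1) = 1.
    by rewrite expRN mulfV // gt_eqF ?expR_gt0.
  by have := expR_gt0 (10^-1 : R); nra.
move=> le_e; have : expR (10^-1 : R) ^+ 12 <= (10 / 9) ^+ 12.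
  by apply: lerXn2r; rewrite ?nnegrE ?expR_ge0 //; lra.
by move/le_trans; apply; rewrite !exprS expr0; lra.
Qed.

Lemma bin_lower_bound (n d s : nat) :
  (2 <= d)%N -> (4 <= s)%N -> (n <= 3 * s + 5)%N ->
  2 / 5 * expR (- 2) * (n%:R / d%:R) ^+ d <= 'C(s.*2, minn s d)%:R :> R.
Proof.
move=> d2 s4 n_le.
have d_gt0 : 0 < d%:R :> R by rewrite ltr0n; lia.
have n_leR : n%:R <= 3 * s%:R + 5 :> R by rewrite -natrM -natrD ler_nat.
have nd_ge0 : 0 <= n%:R / d%:R :> R by rewrite divr_ge0.
(* If [s < d], then [(n/d)^d <= exp (2 n / 5) <= exp (6 s / 5 + 2)], and [exp (6/5) <= 18/5] allows
   comparison with the central coefficient. Otherwise [n] is replaced by [3 s] at the cost of a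
   factor [exp 2], and [bin_scale] reduces to [d = s]-type central coefficients ['C(2 d, d)]. *)
have [lt_sd|le_ds] := ltnP s d.
  apply: le_trans (central_bin_ge s4).
  rewrite -mulrA ler_pM2l; last by lra.
  have le1 : (n%:R / d%:R) ^+ d <= expR (2 / 5 * n%:R) :> R.
    have -> : 2 / 5 * n%:R = d%:R * (2 / 5 * (n%:R / d%:R)) :> R.
      by field; rewrite gt_eqF.
    rewrite expRM_natl; apply: lerXn2r; rewrite ?nnegrE ?expR_ge0 //.
    exact: le_expR_two_fifths.
  have le2 : expR (2 / 5 * n%:R) <= expR (s%:R * (6 / 5) + 2) :> R.
    by rewrite ler_expR; lra.
  rewrite mulrC -(@ler_pdivlMr _ (expR (- 2))) ?expR_gt0 // -expRN opprK.
  apply: le_trans le1 (le_trans le2 _); rewrite expRD expRM_natl.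
  rewrite ler_pM2r ?expR_gt0 //; apply: lerXn2r; rewrite ?nnegrE ?expR_ge0 //.
  exact: expR_six_fifths.
have s_gt0 : 0 < s%:R :> R by rewrite ltr0n; lia.
have le1 : (n%:R / d%:R) ^+ d <= (3 * s%:R / d%:R) ^+ d * expR 2 :> R.
  apply: (@le_trans _ _ ((3 * s%:R / d%:R * expR (2 / d%:R)) ^+ d)).
    apply: lerXn2r; rewrite ?nnegrE //.
    rewrite mulrAC ler_pM2r ?invr_gt0 //.
    have := expR_ge1Dx (2 / d%:R : R).
    have : s%:R * (2 / d%:R) >= 2 :> R.
      by rewrite mulrA ler_pdivlMr // mulrC ler_pM2r // ler_nat.
    by move: (2 / d%:R) (expR _) => y e; nra.
  rewrite exprMn -expRM_natl mulrCA mulfV ?mulr1 // gt_eqF //.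
have le2 : 2 / 3 * (3 * s%:R / d%:R) ^+ d <= 'C(s.*2, d)%:R :> R.
  have dd_gt0 : 0 < (d.*2 ^ d)%:R :> R by rewrite ltr0n expn_gt0; lia.
  have : ('C(d.*2, d) * s.*2 ^ d)%:R <= ('C(s.*2, d) * d.*2 ^ d)%:R :> R.
    by rewrite ler_nat bin_scale // leq_double.
  rewrite [in X in _ <= X]natrM -ler_pdivrMr //; apply: le_trans.
  have -> : (3 * s%:R / d%:R) ^+ d = (3 ^ d)%:R * ((s.*2 ^ d)%:R / (d.*2 ^ d)%:R) :> R.
    rewrite !natrX -expr_div_n -exprMn; congr (_ ^+ _).
    by rewrite -!muln2 !natrM; field; rewrite gt_eqF.
  rewrite natrM mulrA -[leRHS]mulrA ler_wpM2r ?divr_ge0 //.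
  have : (2 * 3 ^ d)%:R <= (3 * 'C(d.*2, d))%:R :> R.
    by rewrite ler_nat central_bin_ge3 //; lia.
  by rewrite !natrM; lra.
have e2 : expR (- 2) * expR 2 = 1 :> R by rewrite -expRD addNr expR0.
have := ler_wpM2l (expR_ge0 (- 2 : R)) le1; rewrite mulrCA e2 mulr1.
have : 0 <= (3 * s%:R / d%:R) ^+ d :> R.
  by rewrite exprn_ge0 // divr_ge0 // ?mulr_ge0 // ltW.
by move: le2 => le2 p0 le3; apply: le_trans le2; rewrite -mulrA; lra.
Qed.

End BinomialBounds.

(** * From testers to counting *)

Section Averaging.
Variables (R : realType) (dm : measure_display) (Omega : measurableType dm).
Variable P : probability Omega R.
Local Open Scope ereal_scope.
Local Open Scope classical_set_scope.

(** Linearity of expectation: the pointwise inequality between sums of indicators is integrated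
    against [P]. *)
Lemma sum_probability_le (I : finType) (A B : I -> set Omega) (M : nat) :
  (forall i, measurable (A i)) -> (forall i, measurable (B i)) ->
  (forall w, (\sum_i (w \in A i) <= \sum_i (w \in B i) + M)%N) ->
  \sum_i P (A i) <= \sum_i P (B i) + M%:R%:E.
Proof.
move=> mA mB leAB.
have sumE (C : I -> set Omega) : (forall i, measurable (C i)) ->
    \sum_i P (C i) = \int[P]_w \sum_i (\1_(C i) w)%:E.
  move=> mC; rewrite ge0_integral_sum //.
  - by apply: eq_bigr => i _; rewrite integral_indic // setIT.
  - by move=> i; apply/measurable_EFinP; exact: measurable_indic.
have meas (C : I -> set Omega) : (forall i, measurable (C i)) ->
    measurable_fun setT (fun w => \sum_i (\1_(C i) w)%:E).
  move=> mC; apply: emeasurable_sum => i.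
  by apply/measurable_EFinP; exact: measurable_indic.
have sum_ge0 (C : I -> set Omega) w : 0 <= \sum_i (\1_(C i) w)%:E.
  by apply: sume_ge0 => i _; rewrite lee_fin.
have -> : M%:R%:E = \int[P]_w (M%:R%:E : \bar R).
  rewrite integral_cst // -[LHS]mule1; congr (_ * _).
  exact/esym/probability_setT.
rewrite !sumE // -ge0_integralD //; last exact: meas.
apply: ge0_le_integral => //.
- exact: meas.
- by apply: emeasurable_funD; [exact: meas | exact: measurable_cst].
move=> w _; rewrite !sumEFin -EFinD lee_fin.
have indicE (C : I -> set Omega) :
    (\sum_i \1_(C i) w = (\sum_i (w \in C i))%:R :> R)%R.
  by rewrite natr_sum; apply: eq_bigr => i _; rewrite indicE.
by rewrite !indicE -natrD ler_nat.
Qed.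

End Averaging.

(* Shifting the seed on the blocks whose central point is queried is a bijection
   of the seeds that turns the view of [no_fun] into the view of [yes_fun]. *)
Lemma same_views (R : realType) (n d q : nat) (i0 : 'I_d) (v : 'I_d -> int)
    (S : 'I_q -> grid n d) (D : ('I_q -> R) -> bool) :
  (forall a b, block i0 v (S a) = block i0 v (S b) -> S a = S b) ->
  (\sum_u D (fun a => yes_fun R i0 v u (S a))
   = \sum_u D (fun a => no_fun R i0 v u (S a)))%N.
Proof.
move=> S_inj; pose c : {ffun {set grid n d} -> 'Z_60} :=
  [ffun B => [exists a, (block i0 v (S a) == B) && central i0 v (S a)]%:R].
rewrite (reindex_inj (addIr c)) /=; apply: eq_bigr => u _.
congr (nat_of_bool (D _)); apply/funext => a; rewrite /yes_fun /no_fun !ffunE.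
congr (_ + (nat_of_ord (_ + _%:R))%:R / _); congr nat_of_bool.
(* All queries in a block are the same point, so the block of [S a] is shifted exactly when [S a] is
   central. *)
apply/existsP/idP => [[b /andP[/eqP/S_inj -> //]] | ca].
by exists a; rewrite eqxx.
Qed.

Section Collisions.
Variables (n d : nat) (i0 i1 : 'I_d).
Implicit Types a b : grid n d.

(** In a common block [b - a = t v] with [t] one of 1, -1, 2, -2, and each [t] determines [v]. *)
Lemma card_pair_collisions a b : a != b ->
  (#|finset (fun w => (w \in directions n i0 i1) &&
      (block i0 (vec w) a == block i0 (vec w) b))| <= 4)%N.
Proof.
move=> ab; set C := finset _.
pose E (t : int) : {set {ffun 'I_d -> 'I_(n.*2).+1}} :=
  finset (fun w => [forall i, (b i : nat)%:Z == (a i : nat)%:Z + t * vec w i]).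
have E1 t : t != 0 -> (#|E t| <= 1)%N.
  move=> t0; apply/card_le1_eqP => w w'; rewrite !inE => /forallP wE /forallP wE'.
  apply: vec_inj => i; apply: (mulfI t0); apply: (@addrI _ (a i : nat)%:Z).
  by rewrite -(eqP (wE i)) -(eqP (wE' i)).
have sub : C \subset (E 1 :|: E (-1)) :|: (E 2 :|: E (-2)).
  apply/fintype.subsetP => w; rewrite inE => /andP[wV /eqP eqb].
  have := wV; rewrite inE => /andP[+ cop]; rewrite inE => /and3P[w0 _ _].
  have v0 : (0 < `|vec w i0|)%N by rewrite absz_gt0.
  have [t t2 tE] := same_block_multiple v0 cop eqb.
  have t0 : t != 0.
    apply: contraNneq ab => t0; apply/eqP/ffunP => i; apply: ord_inj.
    by have := tE i; rewrite t0 mul0r addr0 => -[].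
  have wE : w \in E t by rewrite inE; apply/forallP => i; rewrite tE.
  have : [|| t == 1, t == -1, t == 2 | t == -2] by move: t0 t2; clear; lia.
  by case/or4P => /eqP tE'; rewrite tE' in wE; rewrite !finset.in_setU wE ?orbT.
apply: leq_trans (subset_leq_card sub) _; rewrite !cardsU.
have := E1 1 isT; have := E1 (-1) isT; have := E1 2 isT; have := E1 (-2) isT.
by move: #|E 1| #|E (-1)| #|E 2| #|E (-2)| => e1 e2 e3 e4; lia.
Qed.

Definition collides (q : nat) (S : 'I_q -> grid n d) (v : 'I_d -> int) :=
  [exists a, exists b, (S a != S b) && (block i0 v (S a) == block i0 v (S b))].

Lemma card_collisions (q : nat) (S : 'I_q -> grid n d) :
  (#|finset (fun w => (w \in directions n i0 i1) && collides S (vec w))|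
   <= 4 * q ^ 2)%N.
Proof.
pose C (a b : 'I_q) := finset (fun w => (w \in directions n i0 i1) && ((S a != S b) &&
      (block i0 (vec w) (S a) == block i0 (vec w) (S b)))).
have C4 (a b : 'I_q) : (#|C a b| <= 4)%N.
  have [eqS|neS] := eqVneq (S a) (S b).
    by rewrite eq_card0 // => w; rewrite inE eqS eqxx andbF.
  apply: leq_trans (card_pair_collisions neS); apply/subset_leq_card/fintype.subsetP.
  by move=> w; rewrite !inE neS.
set X := finset _.
have sub : X \subset \bigcup_(ab : 'I_q * 'I_q) C ab.1 ab.2.
  apply/fintype.subsetP => w; rewrite inE.
  move=> /andP[wV /existsP[a /existsP[b ab]]].
  by apply/finset.bigcupP; exists (a, b) => //; rewrite inE wV.
apply: leq_trans (subset_leq_card sub) _.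
apply: (@leq_trans (\sum_(ab : 'I_q * 'I_q) 4)%N).
  apply: (@leq_trans (\sum_(ab : 'I_q * 'I_q) #|C ab.1 ab.2|)%N).
    elim/big_ind2: _ => [|A k B l leA leB|//]; first by rewrite cards0.
    by rewrite cardsU; apply: leq_trans (leq_subr _ _) (leq_add leA leB).
  by apply: leq_sum => ab _.
by rewrite sum_nat_const card_prod !card_ord; lia.
Qed.

End Collisions.

Lemma big_pair_in (T : Type) (idx : T) (op : Monoid.com_law idx) (I J : finType)
    (V : {set I}) (G : I -> J -> T) :
  \big[op/idx]_(z : I * J) (if z.1 \in V then G z.1 z.2 else idx)
  = \big[op/idx]_(x in V) \big[op/idx]_u G x u.
Proof.
rewrite [RHS]big_mkcond -(pair_bigA _ (fun x u => if x \in V then G x u else idx)).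
by apply: eq_bigr => x _ /=; case: ifP => // _; rewrite big1.
Qed.

Section QueryBound.
Variables (R : realType) (n d : nat) (i0 i1 : 'I_d) (eps : R).
Variables (dm : measure_display) (Omega : measurableType dm).
Variables (P : probability Omega R) (q : nat).
Variables (Q : Omega -> 'I_q -> grid n d) (D : Omega -> ('I_q -> R) -> bool).
Hypothesis n_gt0 : (0 < n)%N.
Hypothesis eps_le : eps <= 1 / 10.
Hypothesis tester : nonadaptive_convexity_tester eps P Q D.

Let V := directions n i0 i1.
Let seed : finType := {ffun {set grid n d} -> 'Z_60}.

Let accept (f : grid n d -> R) : set Omega :=
  [set w | D w (fun i => f (Q w i))]%classic.

Let yes w u : grid n d -> R := yes_fun R i0 (vec (n := n) w) u.
Let no w u : grid n d -> R := no_fun R i0 (vec (n := n) w) u.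

Let VP w : w \in V -> [/\ (0 < `|vec w i0|)%N,
  (3 * (\sum_i `|vec w i|) <= n)%N & coprime `|vec w i0|%N `|vec w i1|%N].
Proof.
by rewrite inE => /andP[+ cop]; rewrite inE => /and3P[w0 _ ?]; rewrite absz_gt0.
Qed.

(** Directions without a collision contribute equally to both sums by [same_views]; each of the at
    most [4 q^2] others costs at most one unit per seed. *)
Lemma sum_accept_le (w : Omega) :
  (\sum_(x in V) \sum_(u : seed) D w (fun i => yes x u (Q w i)) <=
   \sum_(x in V) \sum_(u : seed) D w (fun i => no x u (Q w i))
   + 4 * q ^ 2 * #|seed|)%N.
Proof.
apply: (@leq_trans (\sum_(x in V) (\sum_(u : seed) D w (fun i => no x u (Q w i))
    + (if collides i0 (Q w) (vec x) then #|seed| else 0)))%N).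
  apply: leq_sum => x xV; case: ifPn => [_ | nc].
    apply: leq_trans (leq_addl _ _); rewrite -sum1_card.
    by apply: leq_sum => u _; exact: leq_b1.
  rewrite addn0 /yes /no same_views // => a b eqb.
  apply/eqP; apply: contraNT nc => ne.
  by apply/existsP; exists a; apply/existsP; exists b; rewrite ne eqb eqxx.
rewrite big_split leq_add2l -big_mkcondr sum_nat_const leq_mul2r.
apply/orP; right; apply: leq_trans (card_collisions i0 i1 (Q w)).
by apply: eq_leq; apply: eq_card => x; rewrite [RHS]inE.
Qed.

(** Seeds giving a far instance accept with probability at most 1/3; for the others the indicator
    makes the bound exceed 1. *)
Lemma accept_no_le x u : x \in V ->
  (P (accept (no x u)) <=
   (1 / 3 + (#|complete n i0 (vec x)| < 10 * #|wrapped i0 (vec x) u|)%N%:R)%:E)%E.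
Proof.
move=> /VP[v0 small cop]; have [mD [_ far_rej]] := tester.
have [bad|good] := ltnP.
  apply: le_trans (probability_le1 P (mD _)) _.
  by rewrite lee_fin /=; lra.
have := far_rej _ (no_fun_far v0 cop eps_le good (card_complete n_gt0 small v0)).
have -> : [set w | ~~ D w (fun i => no_fun R i0 (vec x) u (Q w i))]%classic
    = (~` accept (no x u))%classic.
  by apply/seteqP; split=> w /= /negP.
rewrite probability_setC ?addr0; last exact: mD.
have : P (accept (no x u)) \is a fin_num by apply: fin_num_measure; exact: mD.
case: (P _) => // p _; rewrite -EFinB !lee_fin.
by lra.
Qed.

(** Averaging over directions and seeds gives [2/3 |V| <= (1/3 + 1/6) |V| + 4 q^2]. *)
Lemma card_directions_le : (#|V| <= 24 * q ^ 2)%N.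
Proof.
have [mD [conv_acc _]] := tester.
(* Pairs outside [V] get the empty event, so that the sums range over a full finite type. *)
pose A (z : _ * seed) := (if z.1 \in V then accept (yes z.1 z.2) else set0)%classic.
pose B (z : _ * seed) := (if z.1 \in V then accept (no z.1 z.2) else set0)%classic.
have mA z : measurable (A z) by rewrite /A; case: ifP => _ //; exact: mD.
have mB z : measurable (B z) by rewrite /B; case: ifP => _ //; exact: mD.
have sumE (F : _ -> seed -> grid n d -> R) w :
  (\sum_z (w \in (if z.1 \in V then accept (F z.1 z.2) else set0)%classic)
   = \sum_(x in V) \sum_u D w (fun i => F x u (Q w i)))%N.
  rewrite -big_pair_in; apply: eq_bigr => z _.
  case: ifP => _; last by rewrite in_set0.
  by congr nat_of_bool; apply/idP/idP; rewrite in_setE.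
have leAB w : (\sum_z (w \in A z) <= \sum_z (w \in B z) + 4 * q ^ 2 * #|seed|)%N.
  by rewrite !sumE; exact: sum_accept_le.
have := sum_probability_le P mA mB leAB.
have lowA : ((\sum_(x in V) \sum_(u : seed) (2 / 3 : R))%:E <= \sum_z P (A z))%E.
  rewrite -big_pair_in -sumEFin; apply: lee_sum => z _.
  rewrite /A; case: ifP => [/VP[v0 _ _]|_]; last by rewrite measure0.
  by apply: conv_acc; exact: yes_fun_convex.
have upB : (\sum_z P (B z) <= (\sum_(x in V) \sum_(u : seed) (1 / 3 +
    (#|complete n i0 (vec x)| < 10 * #|wrapped i0 (vec x) u|)%N%:R : R))%:E)%E.
  rewrite -big_pair_in -sumEFin; apply: lee_sum => z _.
  rewrite /B; case: ifP => [zV|_]; last by rewrite measure0.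
  exact: accept_no_le.
have seed_gt0 : 0 < #|seed|%:R :> R.
  by rewrite ltr0n; apply/card_gt0P; exists [ffun=> 0].
move=> leP; have := le_trans lowA (le_trans leP (leeD upB (le_refl _))).
rewrite -EFinD lee_fin => {}leP.
have : \sum_(x in V) \sum_(u : seed) (1 / 3 +
    (#|complete n i0 (vec x)| < 10 * #|wrapped i0 (vec x) u|)%N%:R)
    <= #|V|%:R * (#|seed|%:R / 2) :> R.
  rewrite mulr_natl -sumr_const; apply: ler_sum => x _.
  rewrite big_split /= sumr_const -natr_sum -mulr_natr.
  have := card_many_wrapped n i0 (vec x).
  rewrite -sum1_card big_mkcond /=.
  rewrite (eq_bigr (fun u : seed =>
    nat_of_bool (#|complete n i0 (vec x)| < 10 * #|wrapped i0 (vec x) u|)%N)).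
    by rewrite -(ler_nat R) natrM; lra.
  by move=> u _; rewrite inE; case: (_ < _)%N.
move: leP; rewrite (eq_bigr (fun=> #|seed|%:R * (2 / 3))); last first.
  by move=> x _; rewrite sumr_const [RHS]mulr_natl.
rewrite sumr_const -mulr_natl !natrM => leP le2.
rewrite -(ler_nat R) !natrM -(ler_pM2r seed_gt0).
by move: leP le2; set a := \sum_(i in V) _; lra.
Qed.

End QueryBound.

(** * The query lower bound *)

Local Open Scope classical_set_scope.

Theorem theorem1p6 (R : realType) :
  exists c : R, 0 < c /\
  exists n0 : nat,
  forall (d n : nat) (eps : R),
    (2 <= d)%N -> (n0 <= n)%N -> eps <= 1 / 10 ->
  forall (dm : measure_display) (Omega : measurableType dm)
         (P : probability Omega R) (q : nat)
         (Q : Omega -> 'I_q -> grid n d) (D : Omega -> ('I_q -> R) -> bool),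
    nonadaptive_convexity_tester eps P Q D ->
    c * ((n%:R / d%:R) `^ (d%:R / 2)) <= q%:R.
Proof.
(* Here 96 is 4 times 24: the loss from imposing coprimality, times the bound on directions per
   [q^2]. *)
pose c2 : R := 2 / 5 * expR (- 2) / 96.
have c2_gt0 : 0 < c2 by rewrite divr_gt0 // mulr_gt0 ?expR_gt0 ?divr_gt0.
exists (Num.sqrt c2); split; first by rewrite sqrtr_gt0.
exists 15%N => d n eps d2 n15 eps_le dm Omega P q Q D tester.
pose i0 : 'I_d := Ordinal (ltnW d2); pose i1 : 'I_d := Ordinal d2.
(* [s] is the largest integer with [3 (s + 1) <= n], and [n >= 15] gives [s >= 4]. *)
pose s := (n %/ 3).-1; pose j := minn s d.
have [s4 sn ns] : [/\ 4 <= s, 3 * s.+1 <= n & n <= 3 * s + 5]%N.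
  by rewrite /s; split; lia.
have nd_ge0 : 0 <= n%:R / d%:R :> R by rewrite divr_ge0.
have low : ('C(s.*2, j) <= 96 * q ^ 2)%N.
  have jP : (2 <= j <= d)%N by rewrite /j; lia.
  have js : (j <= s.*2)%N by rewrite /j; lia.
  apply: leq_trans (@card_short_vecs_ge n d i0 i1 s j erefl erefl jP js sn) _.
  apply: leq_trans (@card_directions n d i0 i1 isT) _.
  have n_gt0 : (0 < n)%N by lia.
  by have := card_directions_le i0 i1 n_gt0 eps_le tester; lia.
rewrite -ler_sqr ?nnegrE ?mulr_ge0 ?sqrtr_ge0 ?powR_ge0 //.
rewrite exprMn sqr_sqrtr ?(ltW c2_gt0) // -powR_mulrn ?powR_ge0 // -powRrM.
rewrite divfK ?pnatr_eq0 // powR_mulrn //.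
have := le_trans (bin_lower_bound R d2 s4 ns) (_ : _ <= (96 * q ^ 2)%:R).
rewrite ler_nat => /(_ low); rewrite natrM natrX /c2.
by set X := (_ / _) ^+ d; move: (expR (- 2)) X (q%:R ^+ 2) => e X y; lra.
Qed.
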